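(* Let $d \geq 2$ be an integer and let $0 \leq s < d-1$. Then the pair $(s,s)$ is admissible; that is, there exist a compact set $K \subset \mathbb{R}^{d}$ and a constant $C > 0$ such that $0 < \mathcal{H}^{s}(K) < \infty$ and $$\mathcal{H}^{s}(K \cap T) \leq C\, w(T)^{s}$$ for all tubes $T \subset \mathbb{R}^{d}$, where $w(T)$ denotes the width of $T$.
   Context: $\mathcal{H}^{s}$ denotes $s$-dimensional Hausdorff measure. A tube $T \subset \mathbb{R}^{d}$ of width $w(T) > 0$ is the $w(T)/2$-neighbourhood of a line in $\mathbb{R}^{d}$. A pair $(s,t) \in [0,d] \times [0,d]$ is called admissible if there exist a compact set $K \subset \mathbb{R}^{d}$ and a constant $C > 0$ such that $0 < \mathcal{H}^{s}(K) < \infty$ and $\mathcal{H}^{s}(K \cap T) \leq C\, w(T)^{t}$ for all tubes $T \subset \mathbb{R}^{d}$. *)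

(* Defs.v *)
From HB Require Import structures.
From mathcomp Require Import all_boot all_order all_algebra.
From mathcomp Require Import all_classical all_reals all_analysis.

Set Implicit Arguments.
Unset Strict Implicit.
Unset Printing Implicit Defensive.

Import Order.TTheory GRing.Theory Num.Theory.
Import numFieldTopology.Exports numFieldNormedType.Exports.

Local Open Scope classical_set_scope.
Local Open Scope ring_scope.

(* The library norm on 'rV[R]_d is the sup norm, so the Euclidean distance is
   defined here. Both induce the same topology, hence the same compact sets. *)
Definition edist (R : realType) (d : nat) (x y : 'rV[R]_d) : R :=
  Num.sqrt (\sum_(i < d) (x 0 i - y 0 i) ^+ 2).

(* Equals -oo on the empty set. *)
Definition ediam (R : realType) (d : nat) (A : set 'rV[R]_d) : \bar R :=
  ereal_sup [set (edist x y)%:E | x in A & y in A].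

(* diam(A)^s, with 0^0 = 1 on nonempty sets and with the empty set
   contributing 0 even when s = 0: thus H^0 is the counting measure. *)
Definition hausdorff_gauge (R : realType) (d : nat) (s : R)
    (A : set 'rV[R]_d) : \bar R :=
  if A == set0 then 0%E else (ediam A `^ s)%E.

(* Coverings are countable; finite ones are obtained by padding with set0. *)
Definition hausdorff_content (R : realType) (d : nat) (s delta : R)
    (A : set 'rV[R]_d) : \bar R :=
  ereal_inf [set (\sum_(0 <= i <oo) hausdorff_gauge s (U i))%E |
    U in [set U : (set 'rV[R]_d)^nat |
      A `<=` \bigcup_i U i /\ forall i, (ediam (U i) <= delta%:E)%E]].

Definition hausdorff_measure (R : realType) (d : nat) (s : R)
    (A : set 'rV[R]_d) : \bar R :=
  ereal_sup [set hausdorff_content s delta A |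
    delta in [set delta : R | 0 < delta]].

Definition is_line (R : realType) (d : nat) (L : set 'rV[R]_d) : Prop :=
  exists a v : 'rV[R]_d, v != 0 /\ L = [set a + t *: v | t in [set: R]].

Definition neighbourhood (R : realType) (d : nat) (r : R)
    (A : set 'rV[R]_d) : set 'rV[R]_d :=
  [set x | exists2 y, A y & edist x y < r].

Definition is_tube (R : realType) (d : nat) (w : R)
    (T : set 'rV[R]_d) : Prop :=
  0 < w /\ exists L, is_line L /\ T = neighbourhood (w / 2) L.

Definition admissible (R : realType) (d : nat) (s t : R) : Prop :=
  [/\ 0 <= s <= d%:R, 0 <= t <= d%:R &
    exists (K : set 'rV[R]_d) (C : R),
      [/\ compact K, 0 < C,
          (0 < hausdorff_measure s K < +oo)%E &
          forall (w : R) (T : set 'rV[R]_d), is_tube w T ->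
            (hausdorff_measure s (K `&` T) <= (C * w `^ t)%:E)%E]].

(* Main.v *)
Require Import Defs.
From mathcomp Require Import all_boot all_order all_algebra.
From mathcomp Require Import all_classical all_reals all_analysis.
From mathcomp Require Import ring lra zify.

(** For s = 0 a single point works. For s > 0 the set K is a random Cantor set
    with rapidly shrinking scales r_0 = 1 > r_1 > ... Stage n consists of N_n
    axis-parallel cubes of side r_n, with N_n * r_n ^ s = 1, and the goal is
    that, for every n and every w >= r_n, a tube of width w meets at most
    C (w / r_n) ^ s cubes of stage n ([sparse_cubes]). This gives everything:
    - covering K, or K intersected with a tube, by the cubes of a late stage
      bounds the Hausdorff measure from above ([hausdorff_limit_set_le]);
    - a ball lies in a tube, so balls meet few cubes as well, and a cover of K
      by sets of diameters e_i must satisfy sum e_i ^ s >= 1 / (2 C), by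
      counting the cubes of a late stage ([hausdorff_limit_set_gt0]).

    To pass from stage n to stage n + 1 ([exists_children]), put
    r_{n+1} = r_n / q and choose in each cube, independently and uniformly,
    M = q ^ s positions for the new cubes in a grid of step r_{n+1}. A tube of
    width k r_{n+1} <= r_n contains a fraction of about (k / q) ^ (d - 1) of the
    positions in a cube of stage n ([card_graph_tube]). Write
    kap = d - 1 - s > 0. If the tube meets boundedly many cubes of stage n, the
    expected number of new cubes on it is at most about k ^ s (k / q) ^ kap,
    smaller than the allowed k ^ s by a power of q / k. Since only polynomially
    many (in q) tubes have to be tested, an exponential moment bound
    ([chernoff_selection]) yields a choice for which all of them are good at
    once, even with the sharp exponent s.

    The constant must not deteriorate from one stage to the next, and this is
    why two constants are carried along. For tubes of width up to 10 r_n a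
    separate bound C1 holds. It reproduces itself: at that width the expected
    number is at most a constant times a negative power of q, so for q large
    the same C1, chosen in terms of d and s, works again at stage n + 1. The
    bound at intermediate widths uses only C1, and for w >= r_n the bound is
    inherited exactly from stage n ([hits_refine]), because a new cube meeting
    a tube lies in an old cube meeting the same tube. *)

Set Implicit Arguments.
Unset Strict Implicit.
Unset Printing Implicit Defensive.

Import Order.TTheory GRing.Theory Num.Theory.
Import numFieldTopology.Exports numFieldNormedType.Exports.

Local Open Scope classical_set_scope.
Local Open Scope ring_scope.

(** * Simultaneous selection by exponential moments *)

(** Exponential moment method for independent uniform choices g j in X: the
    t-th number of successes has mean at most P t, and
    expR (expR (lam t) * P t - lam t * tau t) bounds the probability that it
    reaches tau t. The last hypothesis makes these probabilities add up to less
    than 1. Averaging over all g replaces probability; independence is the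
    distributivity of products over sums. *)
Lemma chernoff_selection (R : realType) (X I : finType) (N : nat)
    (E : I -> 'I_N -> pred X) (P lam tau : I -> R) :
  (0 < #|X|)%N -> (forall t, 0 < lam t) ->
  (forall t, \sum_(j < N) #|E t j|%:R <= P t * #|X|%:R) ->
  (forall t, expR (lam t) * P t + ln #|I|%:R < lam t * tau t) ->
  exists g : {ffun 'I_N -> X},
    forall t, #|[pred j | E t j (g j)]|%:R < tau t.
Proof.
move=> X0 lam0 sumE ineq.
pose Phi t (g : {ffun 'I_N -> X}) : R :=
  expR (- (lam t * tau t)) * \prod_(j < N) expR (lam t *+ E t j (g j)).
have X0' : 0 < #|X|%:R :> R by rewrite ltr0n.
have PhiE t g :
    Phi t g = expR (lam t * (#|[pred j | E t j (g j)]|%:R - tau t)).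
  rewrite /Phi -expR_sum -expRD; congr expR.
  rewrite mulrBr addrC; congr (_ - _).
  rewrite -sum1_card natr_sum mulr_sumr [RHS]big_mkcond/=.
  by apply: eq_bigr => j _; rewrite inE; case: (E t j (g j)); rewrite ?mulr1.
(* the moment bound: the sum over g factors into a product over j *)
have sumPhi t : \sum_g Phi t g <=
    #|X|%:R ^+ N * expR (expR (lam t) * P t - lam t * tau t).
  rewrite -mulr_sumr expRD mulrA [leRHS]mulrC; apply: ler_wpM2l.
    exact: expR_ge0.
  rewrite -(bigA_distr_bigA (fun j x => expR (lam t *+ E t j x))) /=.
  apply: (@le_trans _ _ (\prod_(j < N)
     (#|X|%:R * expR (expR (lam t) * (#|E t j|%:R / #|X|%:R))))).
    apply: ler_prod => j _; rewrite sumr_ge0/=; last first.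
      by move=> ? _; exact: expR_ge0.
    apply: (@le_trans _ _ (#|X|%:R * (1 + expR (lam t) * (#|E t j|%:R / #|X|%:R)))).
      rewrite mulrDr mulr1 mulrCA [X in _ + _ * X]mulrC divfK ?gt_eqF//.
      rewrite -[#|X|]sum1_card -sum1_card !natr_sum mulr_sumr.
      rewrite [X in _ + X]big_mkcond -big_split/=.
      apply: ler_sum => x _.
      have -> : (x \in E t j) = E t j x by [].
      by case: (E t j x); rewrite ?mulr1n ?mulr0n ?expR0 ?addr0// mulr1 lerDr.
    by rewrite ler_pM2l//; exact: expR_ge1Dx.
  rewrite big_split/= prodr_const card_ord; apply: ler_wpM2l.
    exact: exprn_ge0.
  rewrite -expR_sum ler_expR -mulr_sumr; apply: ler_wpM2l; first exact: expR_ge0.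
  by rewrite -mulr_suml ler_pdivrMr.
(* union bound over I *)
have lt1 : \sum_t expR (expR (lam t) * P t - lam t * tau t) < 1.
  case: (posnP #|I|) => [I0|I0].
    rewrite big1 // => t _; have := card0_eq I0 t; by rewrite inE.
  have I0' : 0 < #|I|%:R :> R by rewrite ltr0n.
  apply: (@lt_le_trans _ _ (\sum_(t : I) #|I|%:R^-1)).
    have [t0 _] : exists t0 : I, t0 \in I by move/card_gt0P: I0.
    apply: ltr_sum; first by apply/hasP; exists t0 => //; rewrite mem_index_enum.
    move=> t _; rewrite -[ltRHS]lnK ?posrE ?invr_gt0// ltr_expR lnV ?posrE//.
    by have := ineq t; lra.
  by rewrite sumr_const -[_ *+ _]mulr_natr mulVf// gt_eqF.
apply: contrapT => /forallNP/= noG.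
have : \sum_(g : {ffun 'I_N -> X}) (1 : R) <= \sum_g \sum_t Phi t g.
  apply: ler_sum => g _.
  have [t /negP] : exists t, ~ (#|[pred j | E t j (g j)]|%:R < tau t).
    exact/existsNP/noG.
  rewrite -leNgt => ht.
  rewrite (bigD1 t)//= -[leLHS]addr0; apply: lerD; last first.
    by apply: sumr_ge0 => ? _; rewrite PhiE expR_ge0.
  rewrite PhiE -[leLHS]expR0 ler_expR; apply: mulr_ge0; last by rewrite subr_ge0.
  exact: ltW.
rewrite sumr_const card_ffun card_ord exchange_big/= => H.
have := le_trans H (ler_sum _ (fun t _ => sumPhi t)).
rewrite -mulr_sumr natrX leNgt => /negP; apply.
by rewrite gtr_pMr// exprn_gt0.
Qed.

(** * Lattice points in tubes *)

Lemma card_progression_window (R : realType) (G : nat) (eta v y : R) :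
  0 < eta -> 0 <= v ->
  #|[pred k : 'I_G | `|y - eta * k%:R| <= v]|%:R <= 2 * v / eta + 1.
Proof.
move=> eta0 v0; set A := [pred k : 'I_G | _].
have rhs0 : 0 <= 2 * v / eta by apply: divr_ge0; [apply: mulr_ge0|exact: ltW].
case: (pickP A) => [k1 Ak1|A0]; last first.
  by rewrite (@eq_card0 _ A) ?addr_ge0.
have [k0 Ak0 k0min] := arg_minnP (fun k : 'I_G => k : nat) Ak1.
pose m := Num.truncn (2 * v / eta).
have lem k : A k -> (k - k0 <= m)%N.
  move=> Ak; rewrite truncn_ge_nat// ler_pdivlMr// natrB; last exact: k0min.
  move: Ak Ak0; rewrite !inE !ler_norml => /andP[h1 h2] /andP[h3 h4].
  by lra.
have inj : {in A &, injective (fun k : 'I_G => inord (k - k0) : 'I_m.+1)}.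
  move=> k l Ak Al /(congr1 (@nat_of_ord _)); rewrite !inordK ?ltnS ?lem// => h.
  apply/val_inj => /=; have := k0min _ Ak; have := k0min _ Al => h1 h2.
  by rewrite -(subnK h1) -(subnK h2) h.
rewrite -(card_in_imset inj).
apply: (@le_trans _ _ m.+1%:R).
  by rewrite ler_nat -[leqRHS]card_ord max_card.
by rewrite -natr1 lerD2r; have /andP[] := truncn_itv rhs0.
Qed.

(** Lattice points of a cube near the graph of x_i |-> (f j x_i)_j: for each of
    the G values of the i-th coordinate, every other coordinate is confined to
    a window of length 2 v. *)
Lemma card_graph_tube (R : realType) (d G : nat) (i : 'I_d) (eta v : R)
    (c : 'I_d -> R) (f : 'I_d -> R -> R) : 0 < eta -> 0 <= v ->
  #|[pred g : {ffun 'I_d -> 'I_G} | [forall j, (j != i) ==>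
      (`|c j + eta * (g j)%:R - f j (c i + eta * (g i)%:R)| <= v)]]|%:R
    <= G%:R * (2 * v / eta + 1) ^+ d.-1.
Proof.
move=> eta0 v0; set A := [pred g : {ffun 'I_d -> 'I_G} | _].
rewrite -sum1_card (partition_big (fun g : {ffun 'I_d -> 'I_G} => g i) xpredT)//=.
rewrite natr_sum -[X in _ <= X%:R * _]card_ord mulr_natl -sumr_const.
apply: ler_sum => t _; rewrite sum1_card.
pose F j : pred 'I_G := if j == i then pred1 t
  else [pred k : 'I_G | `|(f j (c i + eta * t%:R) - c j) - eta * k%:R| <= v].
have sub : [pred g : {ffun 'I_d -> 'I_G} | A g && (g i == t)] \subset family F.
  apply/fintype.subsetP => g /andP[/forallP/= gA /eqP git].
  apply/familyP => j; rewrite /F; case: eqP => [->|/eqP ji]; first exact/eqP.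
  by have := gA j; rewrite ji inE -git distrC/=; congr (`|_| <= _); ring.
apply: (@le_trans _ _ #|family F|%:R); first by rewrite ler_nat; exact: subset_leq_card.
rewrite card_family foldrE big_map big_enum/= (bigD1 i)//=.
rewrite [in X in (X * _)%N]/F eqxx card1 mul1n natr_prod.
apply: (@le_trans _ _ (\prod_(j < d | j != i) (2 * v / eta + 1))).
  apply: ler_prod => j ji; rewrite ler0n/= /F (negbTE ji).
  exact: card_progression_window.
by rewrite prodr_const cardC1 card_ord.
Qed.

(** * Tubes and families of cubes *)

Section cubes.
Context {R : realType} {d : nat}.
Implicit Types (a b : 'I_d -> R) (c : nat -> 'rV[R]_d) (A : set 'rV[R]_d).

(** A tube around a line that is a graph over the i-th coordinate axis, measured
    in the sup norm. With slopes b j in [-1, 1], i.e. with i the coordinate along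
    which the direction of the line is largest, every Euclidean tube of width w
    is contained in one of these (see [tube_sub_graph_tube]). *)
Definition graph_tube (i : 'I_d) a b (w : R) : set 'rV[R]_d :=
  [set x | forall j, j != i -> `|x 0 j - (a j + b j * x 0 i)| <= w].

Definition cube (c : 'rV[R]_d) r : set 'rV[R]_d :=
  [set x | forall j, c 0 j <= x 0 j <= c 0 j + r].

Definition hits (N : nat) c (r : R) A : nat :=
  #|[pred j : 'I_N | `[< cube (c j) r `&` A !=set0 >]]|.

Lemma graph_tube_sub i a b w w' : w <= w' ->
  graph_tube i a b w `<=` graph_tube i a b w'.
Proof. by move=> ww' x xT j ji; apply: le_trans (xT j ji) ww'. Qed.

Lemma hits_sub N c r A A' : A `<=` A' -> (hits N c r A <= hits N c r A')%N.
Proof.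
move=> AA'; apply: subset_leq_card; apply/fintype.subsetP => j; rewrite !inE.
by move=> [x [xc xA]]; exists x; split=> //; exact: AA'.
Qed.

Lemma corner_graph_tube i a b w (c : 'rV[R]_d) r : (forall j, `|b j| <= 1) ->
  cube c r `&` graph_tube i a b w !=set0 -> graph_tube i a b (w + 2 * r) c.
Proof.
move=> b1 [x [xc xT]] j ji; have := xT j ji.
have /andP[h1 h2] := xc j; have /andP[h3 h4] := xc i; move=> xj.
have -> : c 0 j - (a j + b j * c 0 i) =
  (x 0 j - (a j + b j * x 0 i)) + (c 0 j - x 0 j) + b j * (x 0 i - c 0 i) by ring.
apply: (le_trans (ler_normD _ _)).
have hb : `|b j * (x 0 i - c 0 i)| <= r.
  rewrite normrM -[leRHS]mul1r; apply: ler_pM => //.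
  by rewrite ger0_norm; lra.
have hc : `|c 0 j - x 0 j| <= r by rewrite ler_norml; lra.
by have := ler_normD (x 0 j - (a j + b j * x 0 i)) (c 0 j - x 0 j); lra.
Qed.

Lemma graph_tube_perturb i a b a' b' w e (x : 'rV[R]_d) :
  (forall j, j != i -> `|a j - a' j| <= e) -> (forall j, `|b j - b' j| <= e) ->
  0 <= x 0 i <= 1 ->
  graph_tube i a b w x -> graph_tube i a' b' (w + 2 * e) x.
Proof.
move=> ha hb /andP[x0 x1] xT j ji.
have -> : x 0 j - (a' j + b' j * x 0 i) =
  (x 0 j - (a j + b j * x 0 i)) + (a j - a' j) + (b j - b' j) * x 0 i by ring.
apply: (le_trans (ler_normD _ _)).
have h : `|(b j - b' j) * x 0 i| <= e.
  by rewrite normrM -[leRHS]mulr1; apply: ler_pM => //; rewrite ger0_norm.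
have := ler_normD (x 0 j - (a j + b j * x 0 i)) (a j - a' j).
by have := xT j ji; have := ha j ji; lra.
Qed.

End cubes.

(** * Numerical conditions for the selection *)

Lemma powR_expR_ln (R : realType) (x p : R) : 0 < x -> x `^ p = expR (p * ln x).
Proof. by move=> x0; rewrite /powR gt_eqF. Qed.

(** Here k is the width of a tube in units of the new side. The exponent lam is
    chosen so that expR lam cancels the gain (k / q) ^ kap in the mean, which
    leaves a multiple of k ^ s. The number of tests, of logarithm l, is
    absorbed because k ^ s * lam >= min (s, kap) * ln q: narrow tubes have a
    large lam, and wide tubes a large k ^ s. *)
Lemma chernoff_wide (R : realType) (s kap q k C1 A D l : R) :
  0 < s -> 0 < kap -> 0 < C1 -> 0 < A -> 0 < D -> 1 <= q ->
  1 <= k <= 2 * q -> l <= D * ln q ->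
  let lam := 1 + kap * ln (2 * q / k) in
  0 < lam /\
  expR lam * (C1 * A * (k `^ s * (k / q) `^ kap)) + l <
  lam * ((expR 1 * 2 `^ kap * C1 * A + D / Num.min s kap) * k `^ s).
Proof.
move=> s0 kap0 C10 A0 D0 q1 /andP[k1 k2q] lD lam.
have q0 : 0 < q by lra.
have k0 : 0 < k by lra.
have L0 : 0 <= ln (2 * q / k) by rewrite ln_ge0// ler_pdivlMr// mul1r.
have lam1 : 1 <= lam by rewrite lerDl mulr_ge0// ltW.
split; first lra.
have -> : expR lam * (C1 * A * (k `^ s * (k / q) `^ kap)) =
    expR 1 * 2 `^ kap * C1 * A * k `^ s.
  rewrite expRD -powR_expR_ln; last by rewrite divr_gt0// mulr_gt0.
  have -> : 2 `^ kap = (2 * q / k) `^ kap * (k / q) `^ kap.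
    rewrite -powRM ?divr_ge0//; try lra.
    by congr (_ `^ _); field; rewrite !gt_eqF.
  by ring.
set mu := Num.min s kap.
have mu0 : 0 < mu by rewrite lt_min s0.
have mus : mu <= s by rewrite ge_min lexx.
have muk : mu <= kap by rewrite ge_min lexx orbT.
set a := expR 1 * _ * _ * A.
have a0 : 0 < a by rewrite !mulr_gt0 ?expR_gt0 ?powR_gt0.
have ks0 : 0 < k `^ s by rewrite powR_gt0.
have x0 : 0 <= ln k by rewrite ln_ge0.
have ks : 1 + s * ln k <= k `^ s by rewrite powR_expR_ln// expR_ge1Dx.
have key : D * ln q < D / mu * (k `^ s * lam).
  rewrite -[ltRHS]mulrA ltr_pM2l// mulrC ltr_pdivlMr//.
  apply: (@lt_le_trans _ _ ((1 + s * ln k) * lam)); last by rewrite ler_pM2r//; lra.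
  have -> : ln q = ln k + ln (2 * q / k) - ln 2.
    rewrite -lnM ?posrE ?divr_gt0 ?invr_gt0 ?mulr_gt0//.
    rewrite -ln_div ?posrE ?divr_gt0 ?invr_gt0 ?mulr_gt0 ?invr_gt0//.
    by congr ln; field; rewrite gt_eqF.
  have : 0 < ln 2 :> R by rewrite ln_gt0// ltr1n.
  rewrite /lam; move: (ln (2 * q / k)) (ln k) (ln 2) L0 x0 => L x y L0 x0 y0.
  have h1 : 0 <= (s - mu) * x by rewrite mulr_ge0// subr_ge0.
  have h2 : 0 <= (kap - mu) * L by rewrite mulr_ge0// subr_ge0.
  have h3 : 0 <= s * x * (kap * L) by rewrite !mulr_ge0// ltW.
  have h4 : 0 < mu * y by rewrite mulr_gt0.
  by nra.
have : a * k `^ s <= a * k `^ s * lam by rewrite ler_peMr//; apply: mulr_ge0; exact: ltW.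
have -> : lam * ((a + D / mu) * k `^ s) =
  a * k `^ s * lam + D / mu * (k `^ s * lam) by ring.
by lra.
Qed.

(** For k fixed the mean is a negative power of q, and lam is chosen so that
    expR lam * mean = 1. Then lam >= kap * ln q / 2 for q large, so the number
    of tests is beaten by a threshold that can be the constant C1 entering
    the mean: a larger C1 only requires a larger q. *)
Lemma chernoff_narrow (R : realType) (s kap q k C1 A D l : R) :
  0 < kap -> 0 < C1 -> 0 < A -> 0 < D -> 0 < k ->
  2 * (D + 1) / kap <= C1 ->
  1 < ln q -> 2 * ln (C1 * A * (k `^ s * k `^ kap)) <= kap * ln q -> l <= D * ln q ->
  let lam := kap * ln q - ln (C1 * A * (k `^ s * k `^ kap)) in
  0 < lam /\
  expR lam * (C1 * A * (k `^ s * (k / q) `^ kap)) + l < lam * C1.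
Proof.
move=> kap0 C10 A0 D0 k0 C1ge L1 LB lD lam.
have q0 : 0 < q.
  by rewrite ltNge; apply/negP => /ln0 h; move: L1; rewrite h ltr10.
set B0 := C1 * A * _ in LB lam *.
have B00 : 0 < B0 by rewrite !mulr_gt0 ?powR_gt0.
have lamge : kap * ln q / 2 <= lam by rewrite /lam; lra.
have kL : 0 < kap * ln q by rewrite mulr_gt0//; lra.
split; first lra.
have -> : expR lam * (C1 * A * (k `^ s * (k / q) `^ kap)) = 1.
  rewrite /lam expRD expRN lnK ?posrE// -powR_expR_ln//.
  rewrite powRM ?invr_ge0 ?ltW// -[q^-1]powR_inv1 ?ltW// powRAC powR_inv1 ?powR_ge0//.
  by rewrite /B0; field; rewrite !gt_eqF// powR_gt0.
apply: (@lt_le_trans _ _ ((D + 1) * ln q)); first lra.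
apply: (@le_trans _ _ (kap * ln q / 2 * C1)); last by rewrite ler_pM2r.
have : kap * ln q / 2 * (2 * (D + 1) / kap) <= kap * ln q / 2 * C1.
  by rewrite ler_pM2l// divr_gt0.
apply: le_trans; rewrite le_eqVlt; apply/orP; left; apply/eqP.
by field; rewrite gt_eqF.
Qed.

(** Turns the lattice count of [card_graph_tube], for M = q ^ s cubes placed in a
    grid of G ~ q points per direction, into the mean used in
    [chernoff_wide] and [chernoff_narrow]. *)
Lemma scaled_count_bound (R : realType) (d : nat) (s kap q k : R) (G : nat) :
  (2 <= d)%N -> s + kap = d%:R - 1 -> 0 < q -> 0 < k -> q / 2 <= G%:R ->
  q `^ s * (G%:R * (11 * k) ^+ d.-1) <=
  22 ^+ d.-1 * (k `^ s * (k / q) `^ kap) * G%:R ^+ d.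
Proof.
move=> d2 skd q0 k0 Gq.
have G0 : 0 < G%:R :> R by lra.
have d1 : (d.-1)%:R = s + kap by rewrite skd -subn1 natrB// (leq_trans _ d2).
have -> : G%:R ^+ d = G%:R * G%:R ^+ d.-1 :> R by rewrite -exprS prednK// (leq_trans _ d2).
rewrite mulrCA [leRHS]mulrCA ler_pM2l//.
have e : k `^ s * (k / q) `^ kap * (q / k) ^+ d.-1 = q `^ s.
  rewrite -powR_mulrn ?divr_ge0 ?ltW// d1 powRD; last first.
    by apply/implyP => _; rewrite gt_eqF// divr_gt0.
  rewrite mulrACA [X in _ * X]mulrC -!powRM ?divr_ge0 ?ltW//.
  have -> : q / k * (k / q) = 1 by field; rewrite !gt_eqF.
  rewrite powR1 mulr1; congr (_ `^ _); by field; rewrite gt_eqF.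
rewrite -e -!mulrA [leRHS]mulrCA ler_pM2l ?powR_gt0//.
rewrite [leRHS]mulrCA ler_pM2l ?powR_gt0 ?divr_gt0//.
rewrite -!exprMn.
have -> : q / k * (11 * k) = 22 * (q / 2) by field; rewrite gt_eqF.
by apply: lerXn2r; rewrite ?nnegrE; lra.
Qed.

(** * Refining a family of cubes *)

Lemma sum_divn (V : nmodType) (N M : nat) (f : nat -> V) :
  \sum_(j < N * M) f (j %/ M)%N = (\sum_(j < N) f j) *+ M.
Proof.
case: (posnP M) => [->|M0]; first by rewrite muln0 big_ord0 mulr0n.
rewrite -(big_mkord xpredT (fun j => f (j %/ M)%N)) -(big_mkord xpredT f).
rewrite big_nat_mul -sumrMnl; apply: eq_big_nat => i _.
rewrite (eq_big_nat _ _ (F2 := fun => f i)).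
  by rewrite sumr_const_nat mulSn addnK.
move=> j /andP[j1 j2]; congr f; apply/eqP; rewrite eqn_leq.
by rewrite leq_divRL// j1 andbT -ltnS ltn_divLR.
Qed.

Lemma hits_refine (R : realType) (d N M : nat) (c c' : nat -> 'rV[R]_d) r r' A :
  (forall j, (j < N * M)%N -> cube (c' j) r' `<=` cube (c (j %/ M)%N) r) ->
  (hits (N * M) c' r' A)%:R <= M%:R * (hits N c r A)%:R :> R.
Proof.
move=> sub; rewrite /hits -!sum1_card -natrM ler_nat [leqRHS]mulnC big_mkcond/=.
pose f j : nat := if `[< cube (c j) r `&` A !=set0 >] then 1%N else 0%N.
rewrite [X in (_ <= X * _)%N]big_mkcond/= (eq_bigr (fun j : 'I_N => f j)); last first.
  by move=> j _; rewrite inE.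
have -> : ((\sum_(j < N) f j) * M = (\sum_(j < N) f j) *+ M)%N.
  by elim: M {sub} => [|m IH]; rewrite ?muln0// mulnS mulrS IH.
rewrite -sum_divn; apply: leq_sum => j _; rewrite /f !inE.
case: asboolP => // -[x [xc xA]]; case: asboolP => // -[]; exists x; split => //.
exact: sub xc.
Qed.

Section rounding.
Context {R : realType}.

Definition clamp (z : R) := Num.max (-1) (Num.min 1 z).

Lemma normr_clamp_le1 z : `|clamp z| <= 1.
Proof.
by rewrite ler_norml le_max ge_max ge_min !lexx/= andbT; lra.
Qed.

Lemma clamp_contract b z : `|b| <= 1 -> `|b - clamp z| <= `|b - z|.
Proof.
rewrite ler_norml /clamp => /andP[h1 h2].
case: (leP 1 z) => h.
  rewrite (max_idPr _); last lra.
  by rewrite distrC [leRHS]distrC !ger0_norm; lra.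
by case: (leP (-1) z) => h' //; rewrite !ger0_norm; lra.
Qed.

Lemma rounding (I : finType) (Q : pred I) (B : nat) (eta : R) (y : I -> R) :
  0 < eta -> 40 / eta < B%:R -> (forall j, Q j -> `|y j| <= 20) ->
  exists al : {ffun I -> 'I_B},
    forall j, Q j -> `|y j - (eta * (al j)%:R - 20)| <= eta.
Proof.
move=> eta0 eB yQ.
have B0 : (0 < B)%N.
  by rewrite -(ltr_nat R); apply: le_lt_trans eB; rewrite divr_ge0// ltW.
have [f fP] : exists f : I -> 'I_B,
    forall j, Q j -> `|y j - (eta * (f j)%:R - 20)| <= eta.
  suff h j : exists k : 'I_B, Q j -> `|y j - (eta * k%:R - 20)| <= eta.
    by have [f fP] := fin_all_exists h; exists f.
  case: (boolP (Q j)) => [Qj|_]; last first.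
    by exists (Ordinal B0).
  have := yQ _ Qj; rewrite ler_norml => /andP[h1 h2].
  have z0 : 0 <= (y j + 20) / eta by apply: divr_ge0; lra.
  have /andP[t1 t2] := truncn_itv z0.
  have tB : (Num.truncn ((y j + 20) / eta) < B)%N.
    rewrite -(ltr_nat R); apply: le_lt_trans eB; apply: (le_trans t1).
    by rewrite ler_pM2r ?invr_gt0//; lra.
  exists (Ordinal tB) => _ /=.
  move: t1 t2; rewrite ler_pdivlMr// -natr1 ltr_pdivrMr// mulrC => t1 t2.
  by rewrite ler_norml; lra.
by exists [ffun j => f j] => j Qj; rewrite ffunE; exact: fP.
Qed.

End rounding.

(** The explicit form of the constants matters only for their independence of
    the stage: C1 can be chosen in terms of d and kap, and C2 is a function of
    d, s, kap and C1. The number 6 * d bounds the degree in q of the number of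
    tubes to be tested. *)
Definition sparsity_constants (R : realType) (d : nat) (s kap C1 C2 : R) : Prop :=
  [/\ 0 < s, 0 < kap, s + kap = d%:R - 1,
    2 * ((6 * d)%:R + 1) / kap <= C1 &
    C2 = (expR 1 * 2 `^ kap * C1 * 22 ^+ d.-1 + (6 * d)%:R / Num.min s kap)
         * 2 `^ s].

Section step.
Context {R : realType} {d : nat}.
Implicit Types (a b : 'I_d -> R) (c : nat -> 'rV[R]_d).

Lemma cube_corner (c : 'rV[R]_d) r : 0 <= r -> cube c r c.
Proof. by move=> r0 j; rewrite lexx lerDl. Qed.

(** The M new cubes in the old cube p are numbered p * M, ..., p * M + M - 1, and
    the position of a new cube in its parent is a point g of a grid. *)
Definition child_corner (G M : nat) (eta : R) c (j : nat)
    (g : {ffun 'I_d -> 'I_G}) : 'rV[R]_d :=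
  c (j %/ M)%N + eta *: \row_l (g l : nat)%:R.

Lemma child_cube_sub (G M : nat) (eta r : R) c j (g : {ffun 'I_d -> 'I_G}) :
  0 < eta -> eta * G%:R <= r ->
  cube (child_corner M eta c j g) eta `<=` cube (c (j %/ M)%N) r.
Proof.
move=> eta0 Gr x xc l; have := xc l; rewrite !mxE => /andP[h1 h2].
have e0 : 0 <= eta * (g l)%:R by rewrite mulr_ge0// ltW.
have : eta * (g l).+1%:R <= eta * G%:R by rewrite ler_pM2l// ler_nat.
by rewrite -natr1 mulrDr mulr1; lra.
Qed.

(** Mean number of new cubes with their corner in a tube of width 5 k eta. Old
    cubes that miss the tube of width 10 r contribute nothing, since
    5 k eta <= 10 r; this is where the bound C1 of the old stage enters. *)
Lemma mean_corners_in_tube (s kap C1 r q eta k : R) (N M G : nat) c i a b :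
  (2 <= d)%N -> s + kap = d%:R - 1 -> 0 < q -> q `^ s = M%:R ->
  0 < eta -> r = eta * q -> G%:R <= q -> q / 2 <= G%:R -> 1 <= k <= 2 * q ->
  0 < C1 -> (hits N c r (graph_tube i a b (10 * r)))%:R <= C1 ->
  \sum_(j < N * M) #|[pred g : {ffun 'I_d -> 'I_G} |
     `[< graph_tube i a b (5 * k * eta) (child_corner M eta c j g) >]]|%:R
  <= C1 * 22 ^+ d.-1 * (k `^ s * (k / q) `^ kap) * #|{ffun 'I_d -> 'I_G}|%:R.
Proof.
move=> d2 skd q0 qM eta0 rE Gq qG /andP[k1 k2] C10 hC1.
have k0 : 0 < k by lra.
have ke0 : 0 < k * eta by rewrite mulr_gt0.
have ke : k * eta <= 2 * r by have := ler_wpM2r (ltW eta0) k2; rewrite rE; lra.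
pose bd := G%:R * (11 * k) ^+ d.-1.
have bd0 : 0 <= bd by rewrite mulr_ge0// exprn_ge0//; lra.
pose U := graph_tube i a b (10 * r).
pose f j : R := if `[< cube (c j) r `&` U !=set0 >] then bd else 0.
apply: (@le_trans _ _ (\sum_(j < N * M) f (j %/ M)%N)).
  apply: ler_sum => j _; rewrite /f; case: asboolP => [_|noU].
    have v0 : 0 <= 5 * k * eta by lra.
    apply: le_trans (le_trans (card_graph_tube G i
      (fun l => c (j %/ M)%N 0 l) (fun l x => a l + b l * x) eta0 v0) _).
      rewrite ler_nat; apply: subset_leq_card; apply/fintype.subsetP => g.
      move=> /asboolP Tg; rewrite inE; apply/forallP => l; apply/implyP => li.
      by have := Tg l li; rewrite !mxE.
    have -> : 2 * (5 * k * eta) / eta = 10 * k by field; rewrite gt_eqF.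
    by apply: ler_wpM2l => //; apply: lerXn2r; rewrite ?nnegrE; lra.
  rewrite eq_card0// => g; apply/negbTE/negP => /asboolP Tg; apply: noU.
  exists (child_corner M eta c j g); split.
    have Gr : eta * G%:R <= r by rewrite rE ler_pM2l.
    by apply: (child_cube_sub eta0 Gr); apply: cube_corner; exact: ltW.
  by apply: graph_tube_sub Tg; lra.
rewrite sum_divn -[leLHS]mulr_natl -qM.
have -> : \sum_(j < N) f j = (hits N c r U)%:R * bd.
  rewrite /hits -sum1_card natr_sum mulr_suml [RHS]big_mkcond/=.
  by apply: eq_bigr => j _; rewrite inE /f mul1r.
apply: (@le_trans _ _ (q `^ s * (C1 * bd))).
  by rewrite ler_pM2l ?powR_gt0// ler_wpM2r.
have h := scaled_count_bound d2 skd q0 k0 qG.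
rewrite mulrCA; apply: le_trans (ler_wpM2l (ltW C10) h) _.
by rewrite card_ffun !card_ord natrX !mulrA.
Qed.

Definition net_intercept (B : nat) (eta : R) (al : {ffun 'I_d -> 'I_B}) j : R :=
  eta * (al j)%:R - 20.

(** Clamped, so that the tubes of the net are themselves tubes with slopes in
    [-1, 1], to which the bounds of the previous stage apply. *)
Definition net_slope (B : nat) (eta : R) (be : {ffun 'I_d -> 'I_B}) j : R :=
  clamp (eta * (be j)%:R - 20).

(** Passing from arbitrary tubes to the net: the width grows by 2 eta when a cube
    is replaced by its corner, and by 2 eta when the tube is replaced by one of
    the net. *)
Lemma hits_le_net_tube (N B : nat) (eta w v : R) c i a b :
  0 < eta -> 40 / eta < B%:R ->
  (forall j, (j < N)%N -> forall x, cube (c j) eta x ->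
    forall l, 0 <= x 0 l <= 1) ->
  (forall j, `|b j| <= 1) -> w <= 10 -> w + 4 * eta <= v ->
  exists al be : {ffun 'I_d -> 'I_B},
    (hits N c eta (graph_tube i a b w) <=
      #|[pred j : 'I_N | `[< graph_tube i (net_intercept eta al)
           (net_slope eta be) v (c j) >]]|)%N.
Proof.
move=> eta0 eB c01 b1 w10 wv.
have B0 : (0 < B)%N.
  by rewrite -(ltr_nat R); apply: le_lt_trans eB; rewrite divr_ge0// ltW.
(* a tube that meets the unit cube has intercepts in [-20, 20] *)
have [[x [xT x01]]|no] := pselect (exists x : 'rV[R]_d,
    graph_tube i a b w x /\ forall l, 0 <= x 0 l <= 1); last first.
  exists [ffun=> Ordinal B0], [ffun=> Ordinal B0].
  rewrite /hits eq_card0// => j.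
  apply/negbTE/negP => /asboolP[x [xc xT]]; apply: no; exists x; split => //.
  exact: c01 (ltn_ord j) _ xc.
have a20 l : l != i -> `|a l| <= 20.
  move=> /xT; have := x01 l; have := x01 i; have := b1 l; rewrite !ler_norml.
  by move=> /andP[? ?] /andP[? ?] /andP[? ?] /andP[? ?]; nra.
have [al alP] := rounding eta0 eB a20.
have [|be beP] := @rounding R _ xpredT B eta b eta0 eB.
  by move=> l _; apply: le_trans (b1 l) _; rewrite ler1n.
exists al, be; rewrite /hits.
apply: subset_leq_card; apply/fintype.subsetP => j /asboolP hit.
rewrite inE.
have cT := corner_graph_tube b1 hit.
have ci : 0 <= c j 0 i <= 1.
  by apply: (c01 _ (ltn_ord j)); apply: cube_corner; exact: ltW.
apply: (@graph_tube_sub _ _ _ _ _ (w + 2 * eta + 2 * eta)); first by lra.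
apply: (graph_tube_perturb alP _ ci cT) => l.
by apply: le_trans (clamp_contract _ (b1 l)) _; exact: beP.
Qed.

Lemma ln_card_net (B K : nat) (q : R) : (2 <= d)%N -> d%:R <= q -> 1 <= q ->
  B%:R <= q ^+ 2 -> K.+1%:R <= q ^+ 2 ->
  ln #|{: 'I_d * ({ffun 'I_d -> 'I_B} * {ffun 'I_d -> 'I_B}) * option 'I_K}|%:R
  <= (6 * d)%:R * ln q.
Proof.
move=> d2 dq q1 Bq Kq; have q0 : 0 < q by lra.
rewrite mulr_natl -lnXn//.
set n := #|_|; have [->|n0] := eqVneq n 0%N.
  by rewrite ln0// ln_ge0// exprn_ege1.
rewrite ler_ln ?posrE ?ltr0n ?lt0n ?exprn_gt0//.
rewrite /n !card_prod !card_ffun card_option !card_ord !natrM !natrX.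
apply: (@le_trans _ _ (q * ((q ^+ 2) ^+ d * (q ^+ 2) ^+ d) * q ^+ 2)).
  by rewrite !ler_pM ?mulr_ge0 ?exprn_ge0 ?lerXn2r ?nnegrE ?exprn_ge0// ltW.
by rewrite -!exprM -exprD -exprS -exprD; apply: ler_weXn2l => //; lia.
Qed.

(** One stage of the construction: the invariant that is carried from stage to
    stage. *)
Definition sparse_cubes (s C1 C2 : R) (N : nat) (r : R) c : Prop :=
  [/\ 0 < r <= 1, N%:R * r `^ s = 1,
    forall j, (j < N)%N -> forall x, cube (c j) r x -> forall i, 0 <= x 0 i <= 1,
    forall i a b, (forall j, `|b j| <= 1) ->
      (hits N c r (graph_tube i a b (10 * r)))%:R <= C1 &
    forall i a b w, (forall j, `|b j| <= 1) -> r <= w ->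
      (hits N c r (graph_tube i a b w))%:R <= C2 * (w / r) `^ s].

(** The random choice. It gives the bounds of the new stage for the tubes of
    width 10 eta and for all widths from eta to r. *)
Lemma exists_children (s kap C1 C3 : R) (N M : nat) (r q eta : R) c :
  (2 <= d)%N -> 0 < s -> 0 < kap -> s + kap = d%:R - 1 ->
  2 * ((6 * d)%:R + 1) / kap <= C1 ->
  C3 = expR 1 * 2 `^ kap * C1 * 22 ^+ d.-1 + (6 * d)%:R / Num.min s kap ->
  (forall j, (j < N)%N -> forall x, cube (c j) r x -> forall i, 0 <= x 0 i <= 1) ->
  (forall i a b, (forall j, `|b j| <= 1) ->
      (hits N c r (graph_tube i a b (10 * r)))%:R <= C1) ->
  q `^ s = M%:R -> 0 < eta -> r = eta * q -> r <= 1 ->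
  42 / r <= q -> d%:R <= q -> 1 < ln q ->
  2 * ln (C1 * 22 ^+ d.-1 * (10 `^ s * 10 `^ kap)) <= kap * ln q ->
  exists c',
  [/\ forall j, (j < N * M)%N -> cube (c' j) eta `<=` cube (c (j %/ M)%N) r,
    forall i a b, (forall j, `|b j| <= 1) ->
      (hits (N * M) c' eta (graph_tube i a b (10 * eta)))%:R <= C1 &
    forall i a b w, (forall j, `|b j| <= 1) -> eta <= w <= r ->
      (hits (N * M) c' eta (graph_tube i a b w))%:R <= C3 * (2 * (w / eta)) `^ s].
Proof.
move=> d2 s0 kap0 skd C1ge C3E c01 HS qM eta0 rE r1 q42 dq lnq1 lnqB.
have r0 : 0 < r.
  rewrite rE mulr_gt0// ltNge; apply/negP => /ln0 h.
  by move: lnq1; rewrite h ltr10.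
have q42' : 42 <= q by apply: le_trans q42; rewrite ler_pdivlMr//; lra.
have q0 : 0 < q by lra.
have q1 : 1 <= q by lra.
have d0 : (0 < d)%N := ltnW d2.
have D0 : 0 < (6 * d)%:R :> R by rewrite ltr0n muln_gt0.
have C10 : 0 < C1.
  by apply: lt_le_trans C1ge; rewrite divr_gt0// mulr_gt0// ltr_wpDl// ltW.
have A0 : 0 < 22 ^+ d.-1 :> R by rewrite exprn_gt0.
have M0 : (0 < M)%N by rewrite -(ltr_nat R) -qM powR_gt0.
have eta1 : 42 * eta <= r by rewrite rE mulrC ler_pM2l.
pose G := Num.truncn q.
have /andP[Gq qG] := truncn_itv (ltW q0 : 0 <= q); rewrite -/G in Gq qG.
have qG2 : q / 2 <= G%:R by clear -qG q42'; move: qG; rewrite -natr1; lra.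
have G0 : (0 < G)%N by rewrite -(ltr_nat R); apply: lt_le_trans qG2; rewrite divr_gt0.
have q20 : 0 <= 2 * q by rewrite mulr_ge0// ltW.
pose K := Num.truncn (2 * q).
have /andP[Kq _] := truncn_itv q20; rewrite -/K in Kq.
have e40 : 0 <= 40 / eta by rewrite divr_ge0// ltW.
pose B := (Num.truncn (40 / eta)).+1.
have /andP[Be eB] := truncn_itv e40; rewrite -/B in eB.
have Bq : B%:R <= q ^+ 2.
  have h : 42 / eta <= q ^+ 2.
    have -> : 42 / eta = 42 / r * q by rewrite rE; field; rewrite !gt_eqF.
    by rewrite expr2 ler_pM2r.
  have h2 : 1 <= 2 / eta.
    by rewrite ler_pdivlMr//; clear -eta1 r1 eta0; lra.
  have e : 42 / eta = 40 / eta + 2 / eta by field; rewrite gt_eqF.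
  by rewrite /B -natr1; clear -h h2 e Be; lra.
have Kq2 : K.+1%:R <= q ^+ 2 by rewrite -natr1; clear -Kq q42'; nra.
(* I: the tubes to be tested. They have their parameters in a net of step eta
   and [-20, 20] contains those of all the tubes that matter. The last component
   is the width: None stands for the tubes of width 10 * eta, which are
   tested against C1, and the others are tested against C3 * k ^ s. *)
pose I : finType :=
  ('I_d * ({ffun 'I_d -> 'I_B} * {ffun 'I_d -> 'I_B}) * option 'I_K)%type.
pose X : finType := {ffun 'I_d -> 'I_G}.
pose kk (o : option 'I_K) : R := if o is Some k then k.+1%:R else 10.
have kk12 o : 1 <= kk o <= 2 * q.
  case: o => [k|] /=; last by clear -q42'; lra.
  by rewrite ler1n/=; apply: le_trans Kq; rewrite ler_nat.
pose T (t : I) := graph_tube t.1.1 (net_intercept eta t.1.2.1)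
  (net_slope eta t.1.2.2) (5 * kk t.2 * eta).
pose E (t : I) (j : 'I_(N * M)) : pred X :=
  [pred g | `[< T t (child_corner M eta c j g) >]].
pose P (t : I) : R := C1 * 22 ^+ d.-1 * (kk t.2 `^ s * (kk t.2 / q) `^ kap).
pose lam (t : I) : R := if t.2 is Some _ then 1 + kap * ln (2 * q / kk t.2)
  else kap * ln q - ln (C1 * 22 ^+ d.-1 * (10 `^ s * 10 `^ kap)).
pose tau (t : I) : R := if t.2 is Some _ then C3 * kk t.2 `^ s else C1.
have lnI : ln #|I|%:R <= (6 * d)%:R * ln q by exact: ln_card_net.
have lamP t : 0 < lam t /\ expR (lam t) * P t + ln #|I|%:R < lam t * tau t.
  rewrite /lam /P /tau; case: t => -[i ab] [k|].
    rewrite C3E; exact: (chernoff_wide s0 kap0 C10 A0 D0 q1 (kk12 (Some k)) lnI).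
  have k0 : 0 < 10 :> R by [].
  exact: (chernoff_narrow kap0 C10 A0 D0 k0 C1ge lnq1 lnqB lnI).
have X0 : (0 < #|X|)%N by rewrite card_ffun !card_ord expn_gt0 G0.
have meanE t : \sum_(j < N * M) #|E t j|%:R <= P t * #|X|%:R.
  apply: (mean_corners_in_tube d2 skd q0 qM eta0 rE Gq qG2 (kk12 t.2) C10).
  by apply: HS => l; exact: normr_clamp_le1.
have [g gP] := chernoff_selection X0 (fun t => (lamP t).1) meanE
  (fun t => (lamP t).2).
pose c' (j : nat) : 'rV[R]_d :=
  if insub j is Some j' then child_corner M eta c j (g j') else 0.
have c'E (j : 'I_(N * M)) : c' j = child_corner M eta c j (g j) by rewrite /c' valK.
have c'sub j : (j < N * M)%N -> cube (c' j) eta `<=` cube (c (j %/ M)%N) r.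
  move=> h; rewrite (c'E (Ordinal h)); apply: child_cube_sub => //.
  by rewrite rE ler_pM2l.
have c'01 j : (j < N * M)%N -> forall x, cube (c' j) eta x ->
    forall l, 0 <= x 0 l <= 1.
  move=> h x xc; apply: (c01 (j %/ M)%N); first by rewrite ltn_divLR.
  exact: c'sub xc.
have count i a b w (o : option 'I_K) : (forall j, `|b j| <= 1) -> w <= 10 ->
    w <= kk o * eta -> exists2 t : I, t.2 = o &
    (hits (N * M) c' eta (graph_tube i a b w))%:R <= tau t.
  move=> b1 w10 wk.
  (* the reason for the width 5 * k * eta of the tubes of the net *)
  have wv : w + 4 * eta <= 5 * kk o * eta.
    have /andP[k1 _] := kk12 o.
    have : eta <= kk o * eta by rewrite ler_peMl// ltW.
    by clear -wk; lra.
  have [al [be le_hits]] := hits_le_net_tube i a eta0 eB c'01 b1 w10 wv.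
  exists (i, (al, be), o) => //; apply: le_trans (ltW (gP _)).
  rewrite ler_nat; apply: leq_trans le_hits _.
  by apply: subset_leq_card; apply/fintype.subsetP => j; rewrite !inE c'E.
exists c'; split=> //.
- move=> i a b b1; have [||[iab o] /= -> h] := count i a b (10 * eta) None b1.
  + by clear -eta1 r1; lra.
  + by [].
  exact: h.
- move=> i a b w b1 /andP[ew wr].
  have we1 : 1 <= w / eta by rewrite ler_pdivlMr// mul1r.
  have weq : w / eta <= q by rewrite ler_pdivrMr// mulrC -rE.
  have we0 : 0 <= w / eta := le_trans ler01 we1.
  have /andP[t1 t2] := truncn_itv we0.
  have kq : (Num.truncn (w / eta)).+1%:R <= 2 * (w / eta).
    by rewrite -natr1; clear -t1 we1; lra.
  have kK : (Num.truncn (w / eta) < K)%N.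
    by rewrite truncn_ge_nat//; apply: le_trans kq _; rewrite ler_pM2l.
  have [||[iab o] /= -> h] := count i a b w (Some (Ordinal kK)) b1.
  + by clear -wr r1; lra.
  + by rewrite /= -ler_pdivrMr// ltW.
  apply: (le_trans h); rewrite /tau/=.
  have C30 : 0 < C3.
    rewrite C3E addr_gt0 ?mulr_gt0 ?expR_gt0 ?powR_gt0//.
    by rewrite invr_gt0 lt_min s0.
  by rewrite ler_pM2l// ge0_ler_powR ?nnegrE ?(ltW s0)// mulr_ge0.
Qed.

(** The inductive step. The hypotheses on q say that it is large in terms of r
    and of the constants, so the scales must decrease very fast. For tubes
    wider than the old cubes, the new bound is the old one times M = q ^ s. *)
Lemma refine_sparse_cubes (s kap C1 C2 : R) (N M : nat) (r q : R) c :
  (2 <= d)%N -> sparsity_constants d s kap C1 C2 -> sparse_cubes s C1 C2 N r c ->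
  q `^ s = M%:R -> 42 / r <= q -> d%:R <= q -> 1 < ln q ->
  2 * ln (C1 * 22 ^+ d.-1 * (10 `^ s * 10 `^ kap)) <= kap * ln q ->
  exists2 c', sparse_cubes s C1 C2 (N * M) (r / q) c' &
    forall j, (j < N * M)%N -> cube (c' j) (r / q) `<=` cube (c (j %/ M)%N) r.
Proof.
move=> d2 [s0 kap0 skd C1ge C2E] [/andP[r0 r1] Nr cubes01 HS HW] qM q42 qd lnq1 lnqB.
have q42' : 42 <= q.
  by apply: le_trans q42; rewrite ler_pdivlMr//; clear -r1; lra.
have q0 : 0 < q by clear -q42'; lra.
have q1 : 1 <= q by clear -q42'; lra.
have M0 : (0 < M)%N by rewrite -(ltr_nat R) -qM powR_gt0.
set eta := r / q; have eta0 : 0 < eta by rewrite divr_gt0.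
have rE : r = eta * q by rewrite /eta divfK ?gt_eqF.
have [c' [c'sub HS' HW']] := exists_children d2 s0 kap0 skd C1ge (erefl _)
  cubes01 HS qM eta0 rE r1 q42 qd lnq1 lnqB.
exists c' => //; split=> //.
- by rewrite eta0/= /eta ler_pdivrMr// mul1r (le_trans r1).
- rewrite natrM -[RHS]Nr -qM /eta; rewrite powRM ?invr_ge0 ?(ltW r0) ?(ltW q0)//.
  rewrite -[q^-1]powR_inv1 ?(ltW q0)// powRAC powR_inv1 ?powR_ge0//.
  by field; rewrite gt_eqF// powR_gt0.
- move=> j h x xc; apply: (cubes01 (j %/ M)%N); first by rewrite ltn_divLR.
  exact: c'sub xc.
- move=> i a b w b1 ew; have [wr|rw] := leP w r.
    rewrite C2E -mulrA -powRM//.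
      by apply: HW' => //; rewrite ew.
    by rewrite divr_ge0 ?(ltW eta0)// (le_trans (ltW eta0)).
  apply: (le_trans (hits_refine _ c'sub)).
  have := HW i a b w b1 (ltW rw).
  rewrite -(ler_pM2l (powR_gt0 s q0)) qM => /le_trans; apply.
  rewrite -qM mulrCA -powRM ?(ltW q0) ?divr_ge0 ?(ltW r0)//; last exact: ltW (lt_trans r0 rw).
  rewrite le_eqVlt; apply/orP; left; apply/eqP; congr (_ * _ `^ _).
  by rewrite /eta; field; rewrite !gt_eqF.
Qed.

End step.

(** * The sequence of stages *)

Section sequence.
Context {R : realType} {d : nat}.

Lemma exists_refinement (s kap C1 C2 : R) (N : nat) (r : R)
    (c : nat -> 'rV[R]_d) :
  (2 <= d)%N -> sparsity_constants d s kap C1 C2 -> sparse_cubes s C1 C2 N r c ->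
  exists N' r' c', [/\ sparse_cubes s C1 C2 N' r' c', r' <= r / 2 &
    forall j, (j < N')%N ->
      exists2 j0, (j0 < N)%N & cube (c' j) r' `<=` cube (c j0) r].
Proof.
move=> d2 consts Hc; have [s0 kap0 _ _ _] := consts.
set B0 := ln (C1 * 22 ^+ d.-1 * (10 `^ s * 10 `^ kap)).
pose Q := 42 / r + d%:R + expR 2 + expR (2 * B0 / kap).
(* q = M ^ (1 / s), so that N * r ^ s = 1 holds exactly at every stage *)
pose M := (Num.truncn (Q `^ s)).+1; pose q := M%:R `^ s^-1.
have [/andP[r0 r1] _ _ _ _] := Hc.
have Qs : [/\ 42 / r <= Q, d%:R <= Q, expR 2 <= Q & expR (2 * B0 / kap) <= Q].
  have h1 : 0 < 42 / r by rewrite divr_gt0.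
  have h2 := expR_gt0 (2 : R); have h3 := expR_gt0 (2 * B0 / kap).
  have h4 : 0 <= d%:R :> R by [].
  by rewrite /Q; split; lra.
case: Qs => Q1 Q2 Q3 Q4.
have Q0 : 0 < Q by apply: lt_le_trans Q3; exact: expR_gt0.
have qM : q `^ s = M%:R by rewrite /q -powRrM mulVf ?gt_eqF// powRr1.
have Qq : Q <= q.
  have -> : Q = (Q `^ s) `^ s^-1 by rewrite -powRrM divff ?gt_eqF// powRr1// ltW.
  rewrite ge0_ler_powR ?invr_ge0 ?(ltW s0)// ?nnegrE ?powR_ge0//.
  by rewrite ltW//; have /andP[] := truncn_itv (powR_ge0 Q s).
have q0 : 0 < q by exact: lt_le_trans Qq.
have lnq2 : 2 <= ln q.
  by rewrite -[leLHS]expRK ler_ln ?posrE ?expR_gt0//; exact: le_trans Qq.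
have lnqB : 2 * B0 / kap <= ln q.
  by rewrite -[leLHS]expRK ler_ln ?posrE ?expR_gt0//; exact: le_trans Qq.
have [||||c' Hc' sub] := refine_sparse_cubes d2 consts Hc qM.
- exact: le_trans Qq.
- exact: le_trans Qq.
- by lra.
- by rewrite [leRHS]mulrC -ler_pdivrMr.
exists (N * M)%N, (r / q), c'; split => //.
  rewrite ler_pM2l// lef_pV2 ?posrE//.
  have : 42 <= 42 / r by rewrite ler_pdivlMr//; lra.
  by lra.
move=> j jN; exists (j %/ M)%N; last exact: sub.
by rewrite ltn_divLR.
Qed.

Lemma exists_sparse_sequence (s : R) :
  (2 <= d)%N -> 0 < s -> s < d%:R - 1 ->
  exists (C : R) (N : nat -> nat) (r : nat -> R) (c : nat -> nat -> 'rV[R]_d),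
  [/\ 0 < C,
    forall n, 0 < r n <= 2^-1 ^+ n /\ (N n)%:R * r n `^ s = 1,
    forall n j, (j < N n.+1)%N -> exists2 j0, (j0 < N n)%N &
      cube (c n.+1 j) (r n.+1) `<=` cube (c n j0) (r n) &
    forall n i a b w, (forall j, `|b j| <= 1) -> r n <= w ->
      (hits (N n) (c n) (r n) (graph_tube i a b w))%:R <= C * (w / r n) `^ s].
Proof.
move=> d2 s0 sd; pose kap := d%:R - 1 - s.
have kap0 : 0 < kap by rewrite subr_gt0.
have skd : s + kap = d%:R - 1 by rewrite /kap addrC subrK.
pose D : R := (6 * d)%:R; pose C1 := 2 * (D + 1) / kap + 1.
have D0 : 0 < D by rewrite ltr0n; lia.
have C11 : 1 <= C1 by rewrite /C1 lerDr divr_ge0 ?(ltW kap0)//; lra.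
pose C3 := expR 1 * 2 `^ kap * C1 * 22 ^+ d.-1 + D / Num.min s kap.
pose C2 := C3 * 2 `^ s.
have consts : sparsity_constants d s kap C1 C2.
  by split=> //; rewrite lerDl.
have pow2 p : 0 < p -> 1 <= 2 `^ p :> R.
  by move=> p0; rewrite -[leLHS](powRr0 2) ler_powR ?ler1n// ltW.
have C31 : 1 <= C3.
  apply: (@le_trans _ _ (expR 1 * 2 `^ kap * C1 * 22 ^+ d.-1)); last first.
    by rewrite lerDl divr_ge0 ?(ltW D0)// le_min !ltW.
  have e1 : 1 <= expR 1 :> R by rewrite -[leLHS]expR0 ler_expR.
  have e2 : 1 <= 22 ^+ d.-1 :> R by rewrite exprn_ege1// ler1n.
  by rewrite !mulr_ege1// pow2.
have C21 : 1 <= C2 by rewrite mulr_ege1 ?pow2.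
pose good (x : nat * R * (nat -> 'rV[R]_d)) :=
  sparse_cubes s C1 C2 x.1.1 x.1.2 x.2.
pose rel (x y : {x | good x}) := (sval y).1.2 <= (sval x).1.2 / 2 /\
  forall j, (j < (sval y).1.1)%N -> exists2 j0, (j0 < (sval x).1.1)%N &
    cube ((sval y).2 j) (sval y).1.2 `<=` cube ((sval x).2 j0) (sval x).1.2.
have relP x : {y | rel x y}.
  apply: cid; case: x => -[[N r] c] /= Hc.
  have [N' [r' [c' [Hc' rr' sub]]]] := exists_refinement d2 consts Hc.
  by exists (exist _ (N', r', c') Hc').
have good0 : good (1%N, 1, fun=> 0).
  split => /=.
  - by rewrite ltr01 lexx.
  - by rewrite powR1 mulr1.
  - by move=> j _ x xc i; have := xc i; rewrite mxE add0r.
  - move=> i a b _; apply: le_trans C11; rewrite (ler_nat _ _ 1).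
    by rewrite -[leqRHS]card_ord max_card.
  - move=> i a b w _ w1; rewrite divr1.
    apply: (@le_trans _ _ 1).
      by rewrite (ler_nat _ _ 1) -[leqRHS]card_ord max_card.
    rewrite mulr_ege1//.
    by rewrite -[leLHS](powRr0 w) ler_powR// ltW.
have [f [f0 fS]] := dependent_choice relP (exist _ _ good0).
exists C2, (fun n => (sval (f n)).1.1), (fun n => (sval (f n)).1.2),
  (fun n => (sval (f n)).2); split.
- by lra.
- move=> n; have [/andP[h1 h2] h3 _ _ _] := svalP (f n); split=> //.
  rewrite h1/=; elim: n {h1 h2 h3} => [|n IH]; first by rewrite f0.
  by apply: le_trans (fS n).1 _; rewrite exprSr ler_pM2r.
- by move=> n; exact: (fS n).2.
- by move=> n; have [_ _ _ _] := svalP (f n).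
Qed.

End sequence.

(** * Topology of nested unions of cubes *)

Lemma nested_compact_sub_open (T : topologicalType) (F : nat -> set T) (O : set T) :
  (forall n, F n.+1 `<=` F n) -> (forall n, closed (F n)) -> compact (F 0%N) ->
  open O -> \bigcap_n F n `<=` O -> exists m, F m `<=` O.
Proof.
move=> FS Fcl F0 Oop FO.
have Fle m n : (m <= n)%N -> F n `<=` F m.
  move=> /subnK <-; elim: (n - m)%N => [//|k IH]; rewrite addSn.
  exact: subset_trans (FS _) IH.
apply: contrapT => /forallNP noM.
have /choice[x xP] m : exists x, F m x /\ ~ O x.
  have /existsNP[x /not_implyP[? ?]] := noM m; by exists x.
have [|p [_ clp]] := F0 (x @ \oo) _.
  by exists 0%N => // n _; have [h _] := xP n; exact: Fle h.
have Op : O p.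
  apply: FO => n _; apply: Fcl => B nB; apply: clp => //.
  by exists n => // k /= nk; have [h _] := xP k; exact: Fle h.
have nO : nbhs p O by apply: open_nbhs_nbhs.
have [|y [nOy Oy]] := clp (~` O) O _ nO.
  by exists 0%N => // k _; have [_] := xP k.
exact: nOy Oy.
Qed.

Section cubes_topology.
Context {R : realType} {d : nat}.

Lemma compact_cube (c : 'rV[R]_d) r : compact (cube c r).
Proof.
have -> : cube c r =
    [set v : 'rV[R]_d | forall i, `[c 0 i, c 0 i + r]%classic (v ord0 i)].
  by apply/seteqP; split => x xc i; have := xc i; rewrite /= in_itv.
apply: (@rV_compact _ _ (fun i => `[c 0 i, c 0 i + r]%classic)) => i.
exact: segment_compact.
Qed.

Definition cubes_union N (c : nat -> 'rV[R]_d) r :=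
  \bigcup_(j in `I_N) cube (c j) r.

Lemma compact_cubes_union N c r : compact (cubes_union N c r).
Proof.
rewrite /cubes_union bigcup_mkord; apply: bigsetU_compact => j _.
exact: compact_cube.
Qed.

Lemma closed_cubes_union N c r : closed (cubes_union N c r).
Proof.
apply: compact_closed; last exact: compact_cubes_union.
exact: norm_hausdorff.
Qed.

End cubes_topology.

(** * Euclidean distance and Hausdorff content *)

Local Notation edist := Defs.edist.
Section euclidean.
Context {R : realType} {d : nat}.
Implicit Types (x y : 'rV[R]_d) (A B : set 'rV[R]_d).

Lemma le_coord_edist x y i : `|x 0 i - y 0 i| <= edist x y.
Proof.
rewrite /edist -sqrtr_sqr ler_wsqrtr// (bigD1 i)//= lerDl.
by apply: sumr_ge0 => *; exact: sqr_ge0.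
Qed.

Lemma edist_le x y r : (forall i, `|x 0 i - y 0 i| <= r) -> 0 <= r ->
  edist x y <= d%:R * r.
Proof.
move=> h r0; rewrite /edist -[leRHS]ger0_norm ?mulr_ge0// -sqrtr_sqr.
rewrite ler_wsqrtr//; apply: (@le_trans _ _ (\sum_(i < d) r ^+ 2)).
  apply: ler_sum => i _; rewrite -real_normK ?num_real// lerXn2r ?nnegrE//.
rewrite sumr_const card_ord -[leLHS]mulr_natl exprMn ler_wpM2r ?sqr_ge0//.
by rewrite -natrX ler_nat; case: (d) => // n; rewrite leq_pmulr.
Qed.

Lemma edist_ge0 x y : 0 <= edist x y.
Proof. exact: sqrtr_ge0. Qed.

Lemma edist_le_ediam A x y : A x -> A y -> ((edist x y)%:E <= ediam A)%E.
Proof. by move=> Ax Ay; apply: ereal_sup_ubound; exists x => //; exists y. Qed.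

Lemma ediam_ge0 A : A !=set0 -> (0 <= ediam A)%E.
Proof.
move=> [x Ax]; apply: le_trans (edist_le_ediam Ax Ax).
by rewrite lee_fin edist_ge0.
Qed.

Lemma ediam_cube (c : 'rV[R]_d) r : 0 <= r -> (ediam (cube c r) <= (d%:R * r)%:E)%E.
Proof.
move=> r0; apply: ge_ereal_sup => _ [x xc [y yc <-]]; rewrite lee_fin.
apply: edist_le => // i; have /andP[h1 h2] := xc i; have /andP[h3 h4] := yc i.
by rewrite ler_norml; lra.
Qed.

Lemma ediam_set0 : ediam (@set0 'rV[R]_d) = -oo%E.
Proof.
by apply/eqP; rewrite -leeNy_eq; apply: ge_ereal_sup => _ [x []].
Qed.

Lemma hausdorff_gauge_ge0 s A : (0 <= hausdorff_gauge s A)%E.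
Proof. by rewrite /hausdorff_gauge; case: ifP => // _; exact: poweR_ge0. Qed.

Lemma hausdorff_gauge_le s A (e : R) : 0 <= s -> 0 <= e -> (ediam A <= e%:E)%E ->
  (hausdorff_gauge s A <= (e `^ s)%:E)%E.
Proof.
move=> s0 e0 Ae; rewrite /hausdorff_gauge; case: ifPn => [_|A0].
  by rewrite lee_fin powR_ge0.
rewrite -poweR_EFin; apply: gt0_ler_poweR => //.
  by rewrite in_itv/= leey andbT; apply/ediam_ge0/set0P.
by rewrite in_itv/= lee_fin e0 leey.
Qed.

(** Parametrise the line by its i-th coordinate, where i maximises |v i|. Moving
    along the line to the point with the same i-th coordinate costs at most
    w / 2 in the other coordinates, besides the w / 2 of the tube itself. *)
Lemma tube_sub_graph_tube w A : (0 < d)%N -> is_tube w A -> exists i a b,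
  (forall j, `|b j| <= 1) /\ A `<=` graph_tube i a b w.
Proof.
move=> d0 [w0 [L [[p [v [v0 ->]] ->]]]].
have [i iP] : exists i : 'I_d, forall j, `|v 0 j| <= `|v 0 i|.
  have [i _ iP] := @arg_maxP _ _ _ (Ordinal d0) xpredT (fun i => `|v 0 i|) isT.
  by exists i => j; exact: iP.
have vi0 : v 0 i != 0.
  apply: contra_neq v0 => vi0; apply/rowP => j; rewrite mxE.
  by apply/eqP; rewrite -normr_eq0 eq_le normr_ge0 andbT -[leRHS](normr0 R) -vi0.
exists i, (fun j => p 0 j - p 0 i * (v 0 j / v 0 i)), (fun j => v 0 j / v 0 i).
have b1 j : `|v 0 j / v 0 i| <= 1.
  by rewrite normrM normfV ler_pdivrMr ?normr_gt0// mul1r.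
split=> // x [_ [t _ <-] xy] j ji.
have hc l : `|x 0 l - (p + t *: v) 0 l| <= w / 2.
  exact: le_trans (le_coord_edist _ _ _) (ltW xy).
have -> : x 0 j - (p 0 j - p 0 i * (v 0 j / v 0 i) + v 0 j / v 0 i * x 0 i) =
  (x 0 j - (p + t *: v) 0 j) - (v 0 j / v 0 i) * (x 0 i - (p + t *: v) 0 i).
  by rewrite !mxE; field.
apply: le_trans (ler_normB _ _) _.
have h : `|v 0 j / v 0 i * (x 0 i - (p + t *: v) 0 i)| <= w / 2.
  by rewrite normrM -[leRHS]mul1r ler_pM.
by have := hc j; lra.
Qed.

Lemma hausdorff_content_le_fin (s delta e : R) (N : nat) (P : pred 'I_N)
    (V : 'I_N -> set 'rV[R]_d) A : 0 <= s -> 0 <= e <= delta ->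
  A `<=` \bigcup_(j in P) V j -> (forall j, ediam (V j) <= e%:E)%E ->
  (hausdorff_content s delta A <= (#|P|%:R * e `^ s)%:E)%E.
Proof.
move=> s0 /andP[e0 ed] AV Ve.
(* pad the finite cover with empty sets *)
pose U n : set 'rV[R]_d := if insub n is Some j then
  (if P j then V j else set0) else set0.
have UE (j : 'I_N) : U j = if P j then V j else set0 by rewrite /U valK.
apply: (@le_trans _ _ (\sum_(0 <= n <oo) hausdorff_gauge s (U n))%E).
  apply: ereal_inf_lbound; exists U => //; split.
    by move=> x /AV[j /= Pj Vx]; exists j => //; rewrite UE Pj.
  move=> n; rewrite /U; case: insub => [j|]; last by rewrite ediam_set0 leNye.
  case: ifP => _; last by rewrite ediam_set0 leNye.
  by apply: le_trans (Ve j) _; rewrite lee_fin.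
rewrite (nneseries_split 0 N); last by move=> *; exact: hausdorff_gauge_ge0.
rewrite eseries0 ?adde0; last first.
  move=> n; rewrite add0n => Nn _; rewrite /U insubN -?leqNgt//.
  by rewrite /hausdorff_gauge eqxx.
rewrite add0n big_mkord -sum1_card natr_sum mulr_suml -sumEFin [leRHS]big_mkcond/=.
apply: lee_sum => j _; rewrite UE -topredE/=; case: ifP => _; last first.
  by rewrite /hausdorff_gauge eqxx.
by rewrite mul1r; apply: hausdorff_gauge_le.
Qed.

End euclidean.


(** * Hausdorff measure of the limit set *)

Section limit_set.
Context {R : realType} {d : nat}.
Variables (N : nat -> nat) (r : nat -> R) (c : nat -> nat -> 'rV[R]_d).
Implicit Types (A : set 'rV[R]_d).

Definition limit_set := \bigcap_n cubes_union (N n) (c n) (r n).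

Lemma compact_limit_set : compact limit_set.
Proof.
apply: (@subclosed_compact _ _ (cubes_union (N 0%N) (c 0%N) (r 0%N))).
- by apply: closed_bigI => n _; exact: closed_cubes_union.
- exact: compact_cubes_union.
- exact: bigcap_inf.
Qed.

Hypothesis rP : forall n, 0 < r n <= 2^-1 ^+ n.

Lemma side_lt e : 0 < e -> exists n0, forall n, (n0 <= n)%N -> r n < e.
Proof.
move=> e0; exists (Num.truncn e^-1).+1 => n hn.
have /andP[rn0 rn] := rP n; apply: (le_lt_trans rn).
rewrite exprVn -[ltRHS]invrK ltf_pV2 ?posrE ?exprn_gt0 ?invr_gt0//.
have /andP[_ h] : ((Num.truncn e^-1)%:R <= e^-1) && (e^-1 < (Num.truncn e^-1).+1%:R).
  by apply: truncn_itv; rewrite invr_ge0 ltW.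
apply: (lt_le_trans h); rewrite -natrX ler_nat; apply: leq_trans hn _.
by rewrite ltnW// ltn_expl.
Qed.

Lemma hausdorff_limit_set_le (s C : R) A (n0 : nat) : 0 <= s ->
  (forall n, (n0 <= n)%N -> (hits (N n) (c n) (r n) A)%:R * r n `^ s <= C) ->
  (hausdorff_measure s (limit_set `&` A) <= (d%:R `^ s * C)%:E)%E.
Proof.
move=> s0 hC; apply: ge_ereal_sup => _ [delta delta0 <-].
have [n1 n1P] : exists n1, forall n, (n1 <= n)%N -> r n < delta / d.+1%:R.
  by apply: side_lt; rewrite divr_gt0.
pose n := maxn n0 n1.
have /andP[rn0 _] := rP n.
have rn : d%:R * r n <= delta.
  have := n1P n (leq_maxr _ _); rewrite ltr_pdivlMr// -natr1; lra.
apply: (@le_trans _ _ ((hits (N n) (c n) (r n) A)%:R * (d%:R * r n) `^ s)%:E).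
  apply: (hausdorff_content_le_fin (V := fun j : 'I_(N n) => cube (c n j) (r n))) => //.
  - by rewrite rn mulr_ge0// ltW.
  - move=> x [Kx Ax]; have [j jN xj] := Kx n I.
    by exists (Ordinal jN) => //=; rewrite inE; exists x.
  - by move=> j; apply: ediam_cube; exact: ltW.
rewrite lee_fin powRM// ?(ltW rn0)// mulrCA ler_wpM2l ?powR_ge0//.
exact: hC (leq_maxl _ _).
Qed.

Hypothesis nested : forall n j, (j < N n.+1)%N -> exists2 j0, (j0 < N n)%N &
  cube (c n.+1 j) (r n.+1) `<=` cube (c n j0) (r n).

Lemma cubes_union_nested n :
  cubes_union (N n.+1) (c n.+1) (r n.+1) `<=` cubes_union (N n) (c n) (r n).
Proof.
move=> x [j jN xj]; have [j0 j0N sub] := nested jN.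
by exists j0 => //; exact: sub.
Qed.

Lemma cubes_union_le m n : (m <= n)%N ->
  cubes_union (N n) (c n) (r n) `<=` cubes_union (N m) (c m) (r m).
Proof.
move=> /subnK <-; elim: (n - m)%N => [//|k IH]; rewrite addSn.
exact: subset_trans (cubes_union_nested (n := _)) IH.
Qed.

(** Working with the cubes of a finite stage, rather than with K, avoids showing
    that every cube contains a point of K. *)
Lemma limit_set_finite_cover (O : nat -> set 'rV[R]_d) :
  (forall i, open (O i)) -> limit_set `<=` \bigcup_i O i ->
  exists m L, cubes_union (N m) (c m) (r m) `<=` \bigcup_(i in `I_L) O i.
Proof.
move=> Oop KO.
have [m mO] := nested_compact_sub_open cubes_union_nested
  (fun n => @closed_cubes_union R d _ _ _) (@compact_cubes_union R d _ _ _)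
  (bigcup_open (fun i _ => Oop i)) KO.
have := @compact_cubes_union R d (N m) (c m) (r m); rewrite compact_cover.
move=> /(_ nat setT O (fun i _ => Oop i) mO)[D _ DO].
exists m, (\max_(i <- finmap.enum_fset D) i).+1 => x /DO[i iD Oix]; exists i => //=.
by rewrite ltnS; apply: (@leq_bigmax_seq _ _ xpredT id).
Qed.

Variables (s C : R).
Hypotheses (d0 : (0 < d)%N) (s0 : 0 < s) (C0 : 0 < C).
Hypothesis Nr : forall n, (N n)%:R * r n `^ s = 1.
Hypothesis tube_hits : forall n i a b w, (forall j, `|b j| <= 1) -> r n <= w ->
  (hits (N n) (c n) (r n) (graph_tube i a b w))%:R <= C * (w / r n) `^ s.

Lemma hits_ball n (x : 'rV[R]_d) rho : r n <= rho ->
  (hits (N n) (c n) (r n) (ball x rho))%:R <= C * (rho / r n) `^ s.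
Proof.
move=> rrho; apply: le_trans (tube_hits (Ordinal d0) (fun j => x 0 j)
  (b := fun=> 0) _ rrho); last by move=> j; rewrite normr0.
rewrite ler_nat; apply: hits_sub => y [_ xy] j _.
by rewrite mul0r addr0 distrC; exact/ltW/xy.
Qed.

(** Mass distribution principle, without a measure: at a late stage, each of the
    N n cubes meets one of finitely many balls, a ball of radius rho meets at
    most C (rho / r n) ^ s of them, and N n = r n ^ - s. *)
Lemma mass_distribution (x : nat -> 'rV[R]_d) (rho : nat -> R) :
  (forall i, 0 < rho i) -> limit_set `<=` \bigcup_i ball (x i) (rho i) ->
  exists L, 1 <= C * \sum_(i < L) rho i `^ s.
Proof.
move=> rho0 Kcov.
have [m [L mL]] := limit_set_finite_cover (fun i => ball_open _ _) Kcov.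
exists L.
have [n0 n0P] : exists n0, forall n, (n0 <= n)%N -> forall i : 'I_L, r n <= rho i.
  elim: L {mL} => [|L [n0 IH]]; first by exists 0%N => n _ [].
  have [n1 n1P] := side_lt (rho0 L); exists (maxn n0 n1) => n.
  rewrite geq_max => /andP[/IH h /n1P h1] i.
  case: (unliftP ord_max i) => [j ->|-> /=]; last exact: ltW.
  by rewrite lift_max; exact: h.
pose n := maxn m n0; have /andP[rn0 _] := rP n.
have NL : (N n <= \sum_(i < L) hits (N n) (c n) (r n) (ball (x i) (rho i)))%N.
  rewrite /hits; under eq_bigr do rewrite -sum1_card big_mkcond/=.
  rewrite exchange_big/= -[leqLHS]card_ord -sum1_card; apply: leq_sum => j _.
  have [i /= iL xb] : (\bigcup_(i in `I_L) ball (x i) (rho i)) (c n j).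
    apply: mL; apply: (cubes_union_le (leq_maxl m n0)); exists j => //=.
    by apply: cube_corner; exact: ltW.
  rewrite (bigD1 (Ordinal iL))//= inE ifT//.
  apply/asboolP; exists (c n j); split => //.
  by apply: cube_corner; exact: ltW.
rewrite -(Nr n) mulr_sumr.
apply: (@le_trans _ _ ((\sum_(i < L) C * (rho i / r n) `^ s) * r n `^ s)).
  rewrite ler_wpM2r ?powR_ge0//.
  apply: (@le_trans _ _ (\sum_(i < L) hits (N n) (c n) (r n) (ball (x i) (rho i)))%:R).
    by rewrite ler_nat.
  by rewrite natr_sum; apply: ler_sum => i _; apply: hits_ball; apply: n0P; exact: leq_maxr.
rewrite mulr_suml; apply: ler_sum => i _.
rewrite -mulrA -powRM ?divr_ge0 ?(ltW rn0) ?(ltW (rho0 _))//.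
by rewrite divfK// gt_eqF.
Qed.

Lemma hausdorff_limit_set_gt0 : (0 < hausdorff_measure s limit_set)%E.
Proof.
apply: (@lt_le_trans _ _ ((2 * C)^-1)%:E).
  by rewrite lte_fin invr_gt0 mulr_gt0.
apply: (@le_trans _ _ (hausdorff_content s 1 limit_set)); last first.
  by apply: ereal_sup_ubound; exists 1 => //=.
apply: le_ereal_inf_tmp => _ [U [KU Ud] <-].
pose e i : R := if U i == set0 then 0 else fine (ediam (U i)).
have gaugeE i : hausdorff_gauge s (U i) = (e i `^ s)%:E /\ 0 <= e i /\
    (forall x y, U i x -> U i y -> edist x y <= e i).
  rewrite /hausdorff_gauge /e; case: eqP => [->|/eqP U0].
    by rewrite powR0 ?gt_eqF.
  have Uge : (0 <= ediam (U i))%E by apply/ediam_ge0/set0P.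
  have Ufin : ediam (U i) \is a fin_num.
    by rewrite ge0_fin_numE//; apply: le_lt_trans (Ud i) _; exact: ltry.
  split; first by rewrite -poweR_EFin fineK.
  split; first exact: fine_ge0.
  by move=> x y Ux Uy; rewrite -lee_fin fineK//; exact: edist_le_ediam.
(* Open balls slightly larger than the U i, at a total cost of 1 / (2 C) in the
   sum of the s-th powers. The positive extra term also gives an open ball when
   U i is a single point or empty. *)
pose rho i := (e i `^ s + (2 * C)^-1 / 2 ^+ i.+1) `^ s^-1.
have t0 i : 0 < (2 * C)^-1 / 2 ^+ i.+1.
  by rewrite divr_gt0 ?invr_gt0 ?mulr_gt0 ?exprn_gt0.
have rho0 i : 0 < rho i by rewrite powR_gt0// ltr_wpDl ?powR_ge0.
have rhos i : rho i `^ s = e i `^ s + (2 * C)^-1 / 2 ^+ i.+1.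
  by rewrite /rho -powRrM mulVf ?gt_eqF// powRr1// addr_ge0 ?powR_ge0 ?ltW.
have erho i : e i < rho i.
  have [_ [ei0 _]] := gaugeE i.
  rewrite ltNge; apply/negP => h.
  have : rho i `^ s <= e i `^ s.
    by rewrite ge0_ler_powR ?nnegrE ?(ltW s0) ?(ltW (rho0 i)).
  by rewrite rhos; have := t0 i; lra.
have /choice[x xP] i : exists x, U i `<=` ball x (rho i).
  have [->|/set0P[x Ux]] := eqVneq (U i) set0; first by exists 0.
  exists x => y Uy; split => // j k; rewrite ord1.
  have [_ [_ h]] := gaugeE i; apply: le_lt_trans (erho i).
  exact: le_trans (le_coord_edist _ _ _) (h _ _ Ux Uy).
have [|L] := @mass_distribution x rho rho0.
  by apply: subset_trans KU _ => z [i _ Uz]; exists i => //; exact: xP.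
under eq_bigr do rewrite rhos.
rewrite big_split/= -mulr_sumr => hL.
have geo : \sum_(i < L) (2 ^+ i.+1)^-1 <= 1 :> R.
  have -> : \sum_(i < L) (2 ^+ i.+1)^-1 = 1 - (2 ^+ L)^-1 :> R.
    elim: L {hL} => [|L IH]; first by rewrite big_ord0 invr1 subrr.
    by rewrite big_ord_recr/= IH exprS; field; rewrite expf_neq0.
  by rewrite gerBl invr_ge0 exprn_ge0.
apply: (@le_trans _ _ (\sum_(0 <= i < L) hausdorff_gauge s (U i))%E); last first.
  by apply: nneseries_lim_ge => *; exact: hausdorff_gauge_ge0.
rewrite big_mkord (eq_bigr (fun i : 'I_L => (e i `^ s)%:E)); last first.
  by move=> i _; have [] := gaugeE i.
rewrite sumEFin lee_fin; move: hL; set S := \sum_(i < L) e i `^ s; move=> hL.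
have h2 : C * ((2 * C)^-1 * (\sum_(i < L) (2 ^+ i.+1)^-1)) <= 2^-1.
  have -> : C * ((2 * C)^-1 * (\sum_(i < L) (2 ^+ i.+1)^-1)) =
    2^-1 * \sum_(i < L) (2 ^+ i.+1)^-1 by field; rewrite gt_eqF.
  by rewrite -[leRHS]mulr1 ler_wpM2l.
rewrite invfM ler_pdivrMr// mulrC; lra.
Qed.

End limit_set.

(** * Admissibility *)

Lemma admissible_0 (R : realType) (d : nat) : admissible d (0 : R) 0.
Proof.
have le1 (A : set 'rV[R]_d) : A `<=` [set 0] -> (hausdorff_measure 0 A <= 1)%E.
  move=> A0; apply: ge_ereal_sup => _ [delta delta0 <-].
  have := @hausdorff_content_le_fin R d 0 delta 0 1 xpredT
    (fun=> [set 0]) A (lexx _).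
  rewrite powRr0 mulr1 card_ord; apply; first by rewrite lexx ltW.
    by move=> x /A0 ->; exists ord0.
  move=> _; apply: ge_ereal_sup => _ [x -> [y -> <-]].
  by rewrite lee_fin; apply: le_trans (edist_le (r := 0) _ _) _;
    rewrite ?mulr0// => i; rewrite subrr normr0.
split; rewrite ?lexx ?ler0n//.
exists [set 0], 1; split => //.
- exact: compact_set1.
- apply/andP; split; last by apply: le_lt_trans (le1 _ _) _ => //; exact: ltry.
  apply: (@lt_le_trans _ _ 1%E) => //.
  apply: (@le_trans _ _ (hausdorff_content 0 1 [set (0 : 'rV[R]_d)])); last first.
    by apply: ereal_sup_ubound; exists 1 => //=.
  apply: le_ereal_inf_tmp => _ [U [KU _] <-].
  have [i _ Ui] := KU 0 erefl.
  apply: (@le_trans _ _ (\sum_(0 <= n < i.+1) hausdorff_gauge 0 (U n))%E); last first.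
    by apply: nneseries_lim_ge => *; exact: hausdorff_gauge_ge0.
  rewrite big_nat_recr//=.
  have -> : hausdorff_gauge 0 (U i) = 1%E.
    rewrite /hausdorff_gauge ifF ?poweRe0//.
    by apply/negbTE/set0P; exists 0.
  by rewrite leeDr// sume_ge0// => *; exact: hausdorff_gauge_ge0.
- move=> w T _; rewrite powRr0 mulr1; apply: le1; exact: subIsetl.
Qed.

Theorem theorem1p2 (R : realType) (d : nat) (s : R)
  (hd : (2 <= d)%N) (hs0 : 0 <= s) (hs : s < d%:R - 1) :
  admissible d s s.
Proof.
have [<-|s_neq0] := eqVneq 0 s; first exact: admissible_0.
have s0 : 0 < s by rewrite lt_def eq_sym s_neq0.
have d0 : (0 < d)%N by apply: leq_trans hd.
have [C [N [r [c [C0 Nr nested tube_hits]]]]] := exists_sparse_sequence hd s0 hs.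
have rP n := (Nr n).1; have {}Nr n := (Nr n).2.
have sd : 0 <= s <= d%:R by rewrite hs0; lra.
split => //; exists (limit_set N r c), (d%:R `^ s * C); split.
- exact: compact_limit_set.
- by rewrite mulr_gt0// powR_gt0// ltr0n.
- rewrite (hausdorff_limit_set_gt0 rP nested d0 s0 C0 Nr tube_hits)/=.
  rewrite -[limit_set _ _ _]setIT.
  apply: le_lt_trans (ltry (d%:R `^ s * 1)).
  apply: (hausdorff_limit_set_le rP (n0 := 0)) => // n _.
  rewrite -[leRHS](Nr n) ler_wpM2r ?powR_ge0// ler_nat -[leqRHS]card_ord.
  exact: max_card.
- move=> w T Tw; have w0 := Tw.1.
  have [i [a [b [b1 Tsub]]]] := tube_sub_graph_tube d0 Tw.
  have [n0 n0P] := side_lt rP w0.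
  rewrite -mulrA; apply: (hausdorff_limit_set_le rP (n0 := n0)) => // n nn.
  have /andP[rn0 _] := rP n.
  apply: (@le_trans _ _ (C * (w / r n) `^ s * r n `^ s)).
    rewrite ler_wpM2r ?powR_ge0//.
    apply: le_trans (tube_hits n i a b w b1 (ltW (n0P _ nn))).
    by rewrite ler_nat; exact: hits_sub.
  by rewrite -mulrA -powRM ?divr_ge0 ?(ltW rn0) ?(ltW w0)// divfK ?gt_eqF.
Qed.
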